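(* Let $A\subseteq\mathbb{Z}^n$ be finite with $\operatorname{conv}(A)=\Delta_1\times\dots\times\Delta_k$, where $\Delta_j=d_j\cdot\operatorname{conv}(0,e_1,\dots,e_{n_j})\subseteq\mathbb{R}^{n_j}$ with $d_j\in\mathbb{N}_{>0}$, $n_j\ge1$, $n=\sum_jn_j$. Let $C_1,\dots,C_k\subseteq[r]$ be the primitive collections of rays of $\Sigma_A$. For $f\in\mathbb{R}[t^{\pm1}]_A$ the following are equivalent: (i) $f$ is strictly $A$-copositive; (ii) $\operatorname{Newt}(f)=\operatorname{conv}(A)$ and there exist $N_1,\dots,N_k\in\mathbb{N}$ with $\prod_{j=1}^k\big(\sum_{i\in C_j}x_i\big)^{N_j}f_{\mathrm{cox}}\in\mathbb{R}_{\ge0}[x_1,\dots,x_r]$; (iii) $\operatorname{Newt}(f)=\operatorname{conv}(A)$ and there exists $N\in\mathbb{N}$ with $\big(\sum_{\sigma\in\Sigma_A(n)}\prod_{i\notin\sigma}x_i\big)^Nf_{\mathrm{cox}}\in\mathbb{R}_{\ge0}[x_1,\dots,x_r]$.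
   Context: Cox setup: $\Sigma_A$ is the inner normal fan of $\operatorname{conv}(A)$, with rays $1,\dots,r$, primitive generators $F_i$ (columns of $F$), $b$ with $\operatorname{conv}(A)=\{a:F^\top a+b\ge0\}$, and $f_{\mathrm{cox}}=\sum_ac_ax^{F^\top a+b}$ for $f=\sum_ac_at^a$. $\Sigma_A(n)$ is the set of maximal cones; $i\notin\sigma$ means ray $i$ is not a ray of $\sigma$. A primitive collection is a set of rays not spanning a cone while each proper subset does. $\operatorname{Newt}(f)$ is the convex hull of the support; $\mathbb{R}_{\ge0}[x]$ are polynomials with nonnegative coefficients. $f$ is strictly $A$-copositive if it lies in the interior of the cone $\{g\in\mathbb{R}[t^{\pm1}]_A: g\ge0\text{ on }\mathbb{R}^n_{>0}\}$ (equivalently, $\sum_jc_{a_j}y_j>0$ on $Y_{\hat A}\cap\mathbb{R}^m_{\ge0}\setminus\{0\}$, with $Y_{\hat A}$ the Zariski closure of $\{(ut^{a_1},\dots,ut^{a_m})\}$). *)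

(* Defs.v *)
From HB Require Import structures.
From mathcomp Require Import all_boot all_order all_algebra.
From mathcomp Require Import reals.
From mathcomp Require Import mpoly.
Set Implicit Arguments. Unset Strict Implicit. Unset Printing Implicit Defensive.
Import Order.TTheory GRing.Theory Num.Theory.
Local Open Scope ring_scope.

Section Defs.
Variable R : realType.

Definition in_conv (m : nat) (S : seq 'rV[R]_m) (x : 'rV[R]_m) : Prop :=
  exists w : 'I_(size S) -> R,
    [/\ forall i, 0 <= w i, \sum_i w i = 1 & x = \sum_i w i *: S`_i].

Definition intvec (n : nat) (a : 'rV[int]_n) : 'rV[R]_n :=
  map_mx (fun z : int => z%:~R) a.

(* m-th coordinate (0-based) of a row vector, 0 if out of range *)
Definition coordf (n : nat) (x : 'rV[R]_n) (m : nat) : R :=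
  \sum_(i < n | val i == m) x 0 i.

(* R^n = R^{ns 0} x ... x R^{ns (k-1)} : offset of block j *)
Definition blk_off (k : nat) (ns : 'I_k -> nat) (j : 'I_k) : nat :=
  (\sum_(l < k | (l < j)%N) ns l)%N.

Definition blockv (k : nat) (ns : 'I_k -> nat) (n : nat) (x : 'rV[R]_n)
  (j : 'I_k) : 'rV[R]_(ns j) :=
  \row_(l < ns j) coordf x (blk_off ns j + l).

Definition simplex_pts (m d : nat) : seq 'rV[R]_m :=
  0 :: [seq d%:R *: (delta_mx 0 l : 'rV[R]_m) | l <- enum 'I_m].

Definition facet_val (n r : nat) (F : 'M[int]_(n, r)) (b : 'rV[int]_r)
  (x : 'rV[R]_n) (i : 'I_r) : R :=
  (x *m map_mx (fun z : int => z%:~R) F) 0 i + (b 0 i)%:~R.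

(* (F, b) is the facet description of conv(A) with primitive inner normals:
   conv(A) = {x : F^T x + b >= 0}, every column of F is a primitive integer
   vector, and no inequality is redundant (so the inequalities are exactly the
   facets, i.e. the rays 1..r of the inner normal fan with generators F_i). *)
Definition cox_data (n r : nat) (A : seq 'rV[int]_n) (F : 'M[int]_(n, r))
  (b : 'rV[int]_r) : Prop :=
  [/\ forall x : 'rV[R]_n,
        in_conv (map (@intvec n) A) x <-> (forall i, 0 <= facet_val F b x i),
      forall i : 'I_r, (\big[gcdn/0%N]_(l < n) `|F l i|)%N = 1%N
    & forall i : 'I_r, exists x : 'rV[R]_n,
        (forall j, j != i -> 0 <= facet_val F b x j) /\ facet_val F b x i < 0].

(* v is a vertex of conv(A) (vertices of conv(A) lie in A) *)
Definition is_vertex (n : nat) (A : seq 'rV[int]_n) (v : 'rV[int]_n) : Prop :=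
  v \in A /\ ~ in_conv (map (@intvec n) [seq a <- A | a != v]) (intvec v).

(* sigma (as its set of rays) is a maximal cone of the inner normal fan:
   the cone of the vertex v is spanned by the normals of the facets through v *)
Definition is_maxcone (n r : nat) (A : seq 'rV[int]_n) (F : 'M[int]_(n, r))
  (b : 'rV[int]_r) (sigma : {set 'I_r}) : Prop :=
  exists v, is_vertex A v /\
    sigma = [set i : 'I_r | ((v *m F) 0 i + b 0 i == 0)%R].

(* the rays in S span a cone of the (simplicial) fan *)
Definition spans_cone (n r : nat) (A : seq 'rV[int]_n) (F : 'M[int]_(n, r))
  (b : 'rV[int]_r) (S : {set 'I_r}) : Prop :=
  exists sigma, is_maxcone A F b sigma /\ S \subset sigma.

Definition primitive_collection (n r : nat) (A : seq 'rV[int]_n)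
  (F : 'M[int]_(n, r)) (b : 'rV[int]_r) (S : {set 'I_r}) : Prop :=
  ~ spans_cone A F b S /\ (forall S' : {set 'I_r}, S' \proper S -> spans_cone A F b S').

Definition supported_on (n : nat) (A : seq 'rV[int]_n) (c : 'rV[int]_n -> R) :=
  forall a, c a != 0 -> a \in A.

Definition leval (n : nat) (A : seq 'rV[int]_n) (c : 'rV[int]_n -> R)
  (t : 'rV[R]_n) : R :=
  \sum_(a <- A) c a * \prod_(i < n) (t 0 i) ^ (a 0 i).

Definition nonneg_on_pos (n : nat) (A : seq 'rV[int]_n) (c : 'rV[int]_n -> R) :=
  forall t : 'rV[R]_n, (forall i, 0 < t 0 i) -> 0 <= leval A c t.

(* f lies in the interior of the cone of A-supported Laurent polynomials that are
   nonnegative on R^n_{>0} (interior w.r.t. the coefficient topology on R^A) *)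
Definition strictly_copositive (n : nat) (A : seq 'rV[int]_n)
  (c : 'rV[int]_n -> R) : Prop :=
  exists2 eps : R, 0 < eps &
    forall c' : 'rV[int]_n -> R, supported_on A c' ->
      (forall a, a \in A -> `|c' a - c a| < eps) -> nonneg_on_pos A c'.

Definition newt_eq_conv (n : nat) (A : seq 'rV[int]_n) (c : 'rV[int]_n -> R) :=
  forall x : 'rV[R]_n,
    in_conv (map (@intvec n) [seq a <- A | c a != 0]) x <->
    in_conv (map (@intvec n) A) x.

(* exponent vector F^T a + b (nonnegative for a in A) *)
Definition cox_exp (n r : nat) (F : 'M[int]_(n, r)) (b : 'rV[int]_r)
  (a : 'rV[int]_n) (i : 'I_r) : nat := absz ((a *m F) 0 i + b 0 i)%R.

Definition fcox (n r : nat) (A : seq 'rV[int]_n) (F : 'M[int]_(n, r))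
  (b : 'rV[int]_r) (c : 'rV[int]_n -> R) : {mpoly R[r]} :=
  \sum_(a <- A) c a *: 'X_[[multinom cox_exp F b a i | i < r]].

Definition nonneg_coeffs (r : nat) (p : {mpoly R[r]}) : Prop :=
  forall m, 0 <= p@_m.

End Defs.

(* Main.v *)
(* An irredundant facet description with primitive normals is unique, so the rays
   of the fan are the coordinate facets and the k "sum" facets of the product.
   They split into k blocks, which are the primitive collections; maximal cones
   omit one ray of each block, whence \sum_sigma \prod_(i \notin sigma) x_i is the
   product of the block sums, and (ii) => (iii).  On every block f_cox is
   homogeneous, so f is controlled by f_cox on the product K of the standard
   simplices.

   (i) => (ii): f minus a small multiple of the sum of all monomials is still
   copositive; hence f_cox is bounded below by a positive constant on K, and
   Polya's argument with falling factorials applies.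

   (iii) => (i): since f_cox does not vanish at the vertices of K, nonnegativity
   of the coefficients of the product bounds f_cox below on K, and the bound
   survives a small perturbation of the coefficients. *)

Require Import Defs.
From HB Require Import structures.
From mathcomp Require Import all_boot all_order all_algebra.
From mathcomp Require Import reals.
From mathcomp Require Import mpoly.
From mathcomp Require Import zify ring lra.
Set Implicit Arguments. Unset Strict Implicit. Unset Printing Implicit Defensive.
Import Order.TTheory GRing.Theory Num.Theory.
Local Open Scope ring_scope.

(** * Nonnegative coefficients and products in the unit interval *)

Section NonnegCoeffs.
Variables (R : realType) (r : nat).
Implicit Types p q : {mpoly R[r]}.

Lemma nonneg_coeffsM p q :
  nonneg_coeffs p -> nonneg_coeffs q -> nonneg_coeffs (p * q).
Proof.
by move=> hp hq m; rewrite mcoeffM; apply: sumr_ge0 => i _; apply: mulr_ge0.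
Qed.

Lemma nonneg_coeffs1 : nonneg_coeffs (1 : {mpoly R[r]}).
Proof. by move=> m; rewrite mcoeff1 ler0n. Qed.

Lemma nonneg_coeffsXn p e : nonneg_coeffs p -> nonneg_coeffs (p ^+ e).
Proof.
move=> hp; elim: e => [|e IHe]; first exact: nonneg_coeffs1.
by rewrite exprS; apply: nonneg_coeffsM.
Qed.

Lemma nonneg_coeffs_prod (I : finType) (G : I -> {mpoly R[r]}) :
  (forall i, nonneg_coeffs (G i)) -> nonneg_coeffs (\prod_i G i).
Proof.
move=> hG; elim/big_ind: _ => //; [exact: nonneg_coeffs1 | exact: nonneg_coeffsM].
Qed.

Lemma nonneg_coeffs_sumX (P : pred 'I_r) :
  nonneg_coeffs (\sum_(i | P i) 'X_i : {mpoly R[r]}).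
Proof.
by move=> m; rewrite raddf_sum; apply: sumr_ge0 => i _ /=; rewrite mcoeffX ler0n.
Qed.

Lemma meval_ge0 p (x : 'I_r -> R) :
  nonneg_coeffs p -> (forall i, 0 <= x i) -> 0 <= p.@[x].
Proof.
move=> hp hx; rewrite mevalE; apply: sumr_ge0 => m _.
by rewrite mulr_ge0 ?prodr_ge0 // => i _; rewrite exprn_ge0.
Qed.

Lemma meval_ge_term p (x : 'I_r -> R) m :
  nonneg_coeffs p -> (forall i, 0 <= x i) ->
  p@_m * \prod_i x i ^+ m i <= p.@[x].
Proof.
move=> hp hx.
have hterm m' : 0 <= p@_m' * \prod_i x i ^+ m' i.
  by rewrite mulr_ge0 ?prodr_ge0 // => i _; rewrite exprn_ge0.
have [hm|] := boolP (m \in msupp p).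
  by rewrite mevalE (bigD1_seq m) ?msupp_uniq //= lerDl sumr_ge0.
rewrite -mcoeff_eq0 => /eqP ->; rewrite mul0r.
exact: meval_ge0.
Qed.

Lemma mcoeff_mulX p (m k : 'X_{1..r}) :
  (p * 'X_[m])@_k = if (m <= k)%MM then p@_(k - m) else 0.
Proof.
case: ifPn => [le_mk | nle].
  by rewrite -{1}(submK le_mk) addmC mcoeffMX.
apply/eqP; rewrite mcoeff_eq0 (perm_mem (msuppMX _ _)).
apply/mapP => -[m' _ eq_k]; move: nle; rewrite eq_k.
by rewrite lem_addr.
Qed.

End NonnegCoeffs.

Section UnitInterval.
Variable R : realDomainType.

(** Telescoping: factors are exchanged one at a time, while all the others have absolute value at
    most 1. *)
Lemma ler_normB_prod (I : Type) (s : seq I) (P Q : I -> R) :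
  (forall i, 0 <= P i <= 1) -> (forall i, 0 <= Q i <= 1) ->
  `|\prod_(i <- s) P i - \prod_(i <- s) Q i| <= \sum_(i <- s) `|P i - Q i|.
Proof.
move=> hP hQ; elim: s => [|i s IHs]; first by rewrite !big_nil subrr normr0.
rewrite !big_cons.
set p := \prod_(j <- s) P j in IHs *; set q := \prod_(j <- s) Q j in IHs *.
have -> : P i * p - Q i * q = (P i - Q i) * p + Q i * (p - q) by ring.
apply: le_trans (ler_normD _ _) _; rewrite !normrM.
have p01 : `|p| <= 1.
  by rewrite normr_prod prodr_ile1 // => j _; rewrite normr_ge0 ger0_norm; have /andP[] := hP j.
have /andP[Q0 Q1] := hQ i.
rewrite (ger0_norm Q0) lerD ?ler_piMr //.
by apply: le_trans IHs; rewrite ler_piMl.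
Qed.

Lemma ler_normB_pow (p q : R) e : 0 <= p <= 1 -> 0 <= q <= 1 ->
  `|p ^+ e - q ^+ e| <= e%:R * `|p - q|.
Proof.
move=> hp hq; have := @ler_normB_prod 'I_e (index_enum _) (fun=> p) (fun=> q).
by rewrite !prodr_const !sumr_const card_ord => H; rewrite mulr_natl; apply: H.
Qed.

End UnitInterval.

(** Induction on [e]: the new factors [(b - e) / M] and [b / M] differ by [e / M], and
    [e ^ 2 + e <= e.+1 ^ 2]. *)
Lemma ffact_ratio_bound (R : realFieldType) (M b e : nat) : (0 < M)%N -> (b <= M)%N ->
  (0 <= ((b ^_ e)%:R / M%:R ^+ e : R) <= 1) /\
  `|(b ^_ e)%:R / M%:R ^+ e - (b%:R / M%:R) ^+ e| <= (e ^ 2)%:R / M%:R :> R.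
Proof.
move=> M0 bM.
have M0R : 0 < M%:R :> R by rewrite ltr0n.
have u01 : 0 <= (b%:R / M%:R : R) <= 1.
  by rewrite divr_ge0 ?ler0n //= ler_pdivrMr // mul1r ler_nat.
elim: e => [|e [q01 IHe]].
  by rewrite ffactn0 !expr0 divr1 subrr normr0 lexx ler01 mul0r.
have step : (b ^_ e.+1)%:R / M%:R ^+ e.+1 =
    (b ^_ e)%:R / M%:R ^+ e * ((b%:R - e%:R) / M%:R) :> R.
  rewrite ffactnSr natrM exprSr.
  (* For [b < e] natural subtraction truncates, but then [b ^_ e] is already 0. *)
  have [eb|be] := leqP e b; first by rewrite natrB // invfM mulrACA.
  by rewrite ffact_small // !mul0r.
set q := (b ^_ e)%:R / _ in q01 IHe step *.
set u := b%:R / M%:R in u01 IHe *.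
split.
  rewrite divr_ge0 ?ler0n ?exprn_ge0 ?ler0n //=.
  rewrite ler_pdivrMr ?exprn_gt0 // mul1r -natrX ler_nat.
  apply: leq_trans (_ : b ^ e.+1 <= _)%N; last by rewrite leq_exp2r.
  by elim: (e.+1) => // e' IHe'; rewrite ffactnSr expnSr leq_mul // leq_subr.
have -> : (b ^_ e.+1)%:R / M%:R ^+ e.+1 - u ^+ e.+1
    = (q - u ^+ e) * u - q * (e%:R / M%:R).
  by rewrite step exprSr /u; ring.
apply: le_trans (ler_normB _ _) _.
have [/andP[q0 q1] /andP[u0 u1]] := (q01, u01).
have em0 : 0 <= e%:R / M%:R :> R by rewrite divr_ge0 ?ler0n.
rewrite normrM (ger0_norm u0) (ger0_norm (mulr_ge0 q0 em0)).
apply: le_trans (_ : (e ^ 2)%:R / M%:R + e%:R / M%:R <= _).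
  apply: lerD; last by rewrite ler_piMl.
  by apply: le_trans IHe; rewrite ler_piMr.
rewrite -mulrDl; apply: ler_wpM2r; first by rewrite invr_ge0 ler0n.
by rewrite -natrD ler_nat; lia.
Qed.

Lemma exists_pos_lower_bound (R : realDomainType) (I : finType) (f : I -> R) :
  (forall i, 0 < f i) -> exists2 e, 0 < e & forall i, e <= f i.
Proof.
move=> f0; exists (\big[Order.min/1]_i f i); first by apply/lt_bigmin.
by move=> i; apply: bigmin_le_cond.
Qed.

(** * Polya's theorem on a product of simplices *)

Section Blocks.
Variables (R : realType) (r k : nat) (B : 'I_r -> 'I_k).
Implicit Types (p : {mpoly R[r]}) (x : 'I_r -> R).

Let bdeg (m : 'X_{1..r}) (j : 'I_k) := (\sum_(i | B i == j) m i)%N.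
Let sigma (j : 'I_k) : {mpoly R[r]} := \sum_(i | B i == j) 'X_i.

(** The multinomial theorem in each block, multiplied by [m!] to avoid division. One linear form is
    split off at a time. *)
Lemma mcoeff_prod_blocks (N : 'I_k -> nat) (m : 'X_{1..r}) :
  (\prod_j sigma j ^+ N j)@_m * \prod_i ((m i)`!)%:R =
  if [forall j, bdeg m j == N j] then \prod_j ((N j)`!)%:R else 0.
Proof.
(* The exponents vary in the induction, so it runs on a bound for their sum. *)
move: {2}(\sum_j N j)%N (leqnn (\sum_j N j)) => s.
elim: s N m => [|s IHs] N m.
  rewrite leqn0 sum_nat_eq0 => /forallP N0.
  have {}N0 j : N j = 0%N by apply/eqP; have := N0 j.
  rewrite big1 => [|j _]; last by rewrite N0 expr0.
  rewrite mcoeff1; have [->|m0] := eqVneq m 0%MM.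
    rewrite mul1r big1 => [|i _]; last by rewrite mnm0E.
    have -> : [forall j, bdeg 0%MM j == N j].
      by apply/forallP => j; rewrite N0 /bdeg big1 // => i _; rewrite mnm0E.
    by rewrite big1 // => j _; rewrite N0.
  rewrite mul0r; case: ifP => // /forallP mN; case/negP: m0.
  apply/eqP/mnmP => i; rewrite mnm0E.
  have := mN (B i); rewrite N0 /bdeg (bigD1 i) //= addn_eq0.
  by case/andP => /eqP.
case: (boolP [forall j, N j == 0%N]) => [/forallP N0 _|].
  by apply: IHs; rewrite big1 // => j _; apply/eqP.
rewrite negb_forall => /existsP[j0]; rewrite -lt0n => Nj0 sN.
pose N' j := if j == j0 then (N j).-1 else N j.
have sN' : (\sum_j N' j <= s)%N.
  rewrite -ltnS; apply: leq_trans sN.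
  rewrite (bigD1 j0) //= [ltnRHS](bigD1 j0) //= /N' eqxx -(prednK Nj0) addSn ltnS.
  by rewrite leq_add2l leq_sum // => j /negbTE ->.
have splitN : \prod_j sigma j ^+ N j = sigma j0 * \prod_j sigma j ^+ N' j.
  rewrite (bigD1 j0) //= [in RHS](bigD1 j0) //= mulrA /N' eqxx -exprS prednK //.
  by congr (_ * _); apply: eq_bigr => j /negbTE ->.
have eqF : \prod_j ((N j)`!)%:R = (N j0)%:R * \prod_j ((N' j)`!)%:R :> R.
  rewrite (bigD1 j0) //= [in RHS](bigD1 j0) //= mulrA /N' eqxx -{1 2}(prednK Nj0).
  rewrite factS natrM.
  by congr (_ * _); apply: eq_bigr => j /negbTE ->.
rewrite splitN; set q := \prod_j sigma j ^+ N' j in IHs *.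
rewrite mulr_suml raddf_sum mulr_suml /=.
(* Splitting off ['X_i] turns [m!] into [m i] times the factorial of [m - U_(i)]; for [m i = 0] both
   sides vanish. *)
have term i : B i == j0 -> ('X_i * q)@_m * \prod_i ((m i)`!)%:R =
   (m i)%:R * (if [forall j, bdeg m j == N j] then \prod_j ((N' j)`!)%:R else 0).
  move=> Bi; rewrite mulrC [X in X@__]mulrC mcoeff_mulX lep1mP.
  have [->|mi0] := eqVneq (m i) 0%N; first by rewrite mulr0 mul0r.
  have -> : \prod_i ((m i)`!)%:R = (m i)%:R * \prod_i' (((m - U_(i))%MM i')`!)%:R :> R.
    rewrite (bigD1 i) //= [in RHS](bigD1 i) //= mulrA; congr (_ * _).
      by rewrite -natrM mnmBE mnm1E eqxx subn1 -{1 2}(prednK (n := m i)) ?lt0n // factS.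
    by apply: eq_bigr => i' /negbTE ni; rewrite mnmBE mnm1E eq_sym ni subn0.
  rewrite /= -mulrA [X in _ * X = _]mulrC; congr (_ * _).
  rewrite IHs //; congr (if _ then _ else _).
  apply: eq_forallb => j.
  have eqd : (bdeg m j = bdeg (m - U_(i)) j + (j == j0))%N.
    rewrite /bdeg; have [->|nj] := eqVneq j j0.
      rewrite (bigD1 i) //= [X in (_ = X + _)%N](bigD1 i) //= mnmBE mnm1E eqxx.
      have -> : (\sum_(i0 < r | (B i0 == j0) && (i0 != i)) (m - U_(i))%MM i0 =
        \sum_(i0 < r | (B i0 == j0) && (i0 != i)) m i0)%N.
        by apply: eq_bigr => i' /andP[_ /negbTE ni]; rewrite mnmBE mnm1E eq_sym ni subn0.
      by rewrite addnAC subnK ?lt0n.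
    rewrite addn0; apply: eq_bigr => i' Bi'; rewrite mnmBE mnm1E.
    case: eqP => [ii|]; last by rewrite subn0.
    by move: nj; rewrite -(eqP Bi') -ii (eqP Bi) eqxx.
  rewrite eqd /N'; have [->|nj] := eqVneq j j0; last by rewrite addn0.
  by rewrite addn1 -{2}(prednK Nj0) eqSS.
(* The weights [m i] of block [j0] add up to [N j0], the factor missing from [(N' j0)!]. *)
rewrite (eq_bigr _ term) -mulr_suml -natr_sum.
case: ifP => [/forallP mN|]; last by rewrite mulr0.
by rewrite eqF -[(\sum_(i < r | _) _)%N]/(bdeg m j0) (eqP (mN j0)).
Qed.

(** Dividing [m!] by [(m - a)!] leaves falling factorials. These vanish when [a] does not divide
    [m], so no case distinction remains. *)
Lemma mcoeff_prod_blocksMX (N d : 'I_k -> nat) (a m : 'X_{1..r}) :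
  (forall j, bdeg a j = d j) ->
  (\prod_j sigma j ^+ N j * 'X_[a])@_m * \prod_i ((m i)`!)%:R =
  (if [forall j, bdeg m j == (N j + d j)%N] then \prod_j ((N j)`!)%:R else 0)
  * \prod_i (m i ^_ a i)%:R.
Proof.
move=> ad; rewrite mcoeff_mulX; case: ifPn => [/mnm_lepP le_am|nle]; last first.
  have [i lt_ma] : exists i, (m i < a i)%N.
    apply/existsP; apply: contraR nle => /existsPn le_am.
    by apply/mnm_lepP => i; rewrite leqNgt.
  by rewrite mul0r (bigD1 i) //= ffact_small // mul0r mulr0.
have -> : \prod_i ((m i)`!)%:R =
    \prod_i (((m - a)%MM i)`!)%:R * \prod_i (m i ^_ a i)%:R :> R.
  rewrite -big_split /=; apply: eq_bigr => i _.
  by rewrite mnmBE mulrC -natrM ffact_fact.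
rewrite mulrA mcoeff_prod_blocks; congr (_ * _).
congr (if _ then _ else _); apply: eq_forallb => j.
rewrite -ad -(eqn_add2r (bdeg a j)) /bdeg -big_split /=; congr (_ == _).
by apply: eq_bigr => i _; rewrite mnmBE subnK.
Qed.

Lemma prod_expr_block (d : 'I_k -> nat) (a : 'X_{1..r}) (z : 'I_k -> R) :
  (forall j, bdeg a j = d j) -> \prod_i z (B i) ^+ a i = \prod_j z j ^+ d j.
Proof.
move=> ad; rewrite (partition_big B predT) //=; apply: eq_bigr => j _.
by rewrite -ad /bdeg -prodrXr; apply: eq_bigr => i /eqP ->.
Qed.

(* The coefficient of [x^m] in the product is, up to a positive factor, the value
   at the normalized point [m i / M (B i)] of [p] with powers replaced by falling
   factorials, which converges to [p] uniformly as [N] grows. *)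
Lemma polya_blocks (p : {mpoly R[r]}) (d : 'I_k -> nat) (lam : R) :
  (forall a, a \in msupp p -> forall j, bdeg a j = d j) -> 0 < lam ->
  (forall x : 'I_r -> R, (forall i, 0 <= x i) ->
     (forall j, \sum_(i | B i == j) x i = 1) -> lam <= p.@[x]) ->
  exists N, nonneg_coeffs (\prod_j sigma j ^+ N * p).
Proof.
move=> hp lam0 hlam.
(* [C / N] will bound the total error of replacing powers by falling factorials, so [N] is taken
   above [C / lam]. *)
pose C := \sum_(a <- msupp p) `|p@_a| * \sum_i (a i ^ 2)%:R.
have C0 : 0 <= C.
  by apply: sumr_ge0 => a _; rewrite mulr_ge0 // sumr_ge0 // => i _; rewrite ler0n.
pose N := Num.Def.archi_bound (C / lam).
have CN : C / lam < N%:R by apply: archi_boundP; rewrite divr_ge0 // ltW.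
have N0 : (0 < N)%N.
  by rewrite -(ltr0n R); apply: le_lt_trans CN; rewrite divr_ge0 // ltW.
exists N => m.
pose Q := \prod_j sigma j ^+ N.
have fact0 : 0 < \prod_i ((m i)`!)%:R :> R.
  by apply: prodr_gt0 => i _; rewrite ltr0n fact_gt0.
rewrite -(pmulr_lge0 _ fact0).
rewrite -/Q {1}[p]mpolyE mulr_sumr raddf_sum mulr_suml /= big_seq.
under eq_bigr => a ap do
  rewrite -scalerAr mcoeffZ -mulrA (mcoeff_prod_blocksMX (fun=> N) _ (hp a ap)) mulrCA.
(* All monomials of [p] have multidegree [d], so the condition on [m] is the same for all of them
   and factors out. *)
rewrite -big_seq -mulr_sumr; case: ifPn => [/forallP mN|_]; last by rewrite mul0r.
apply: mulr_ge0; first by apply: prodr_ge0.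
pose M j := (N + d j)%N.
have M0 j : (0 < M j)%N by rewrite /M addn_gt0 N0.
have M0R j : 0 < (M j)%:R :> R by rewrite ltr0n.
have mM i : (m i <= M (B i))%N.
  by rewrite /M -(eqP (mN (B i))) /bdeg (bigD1 i) //= leq_addr.
pose y i : R := (m i)%:R / (M (B i))%:R.
have y0 i : 0 <= y i by rewrite divr_ge0.
have y1 j : \sum_(i | B i == j) y i = 1.
  rewrite /y; under eq_bigr => i /eqP -> do [].
  by rewrite -mulr_suml -natr_sum -/(bdeg m j) (eqP (mN j)) divff // gt_eqF.
have := hlam y y0 y1; rewrite mevalE => hy.
(* By block homogeneity this one constant normalizes every monomial of [p]. *)
pose D : R := \prod_j (M j)%:R ^+ d j.
have D0 : 0 < D by apply: prodr_gt0 => j _; rewrite exprn_gt0.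
suff : 0 <= (\sum_(a <- msupp p) p@_a * \prod_i (m i ^_ a i)%:R) / D.
  by rewrite pmulr_lge0 // invr_gt0.
pose P (a : 'X_{1..r}) i : R := (m i ^_ a i)%:R / (M (B i))%:R ^+ a i.
have -> : (\sum_(a <- msupp p) p@_a * \prod_i (m i ^_ a i)%:R) / D =
    \sum_(a <- msupp p) p@_a * \prod_i P a i.
  rewrite mulr_suml big_seq [RHS]big_seq; apply: eq_bigr => a ap.
  rewrite -mulrA /P big_split /=; congr (_ * (_ * _)).
  by rewrite prodfV (prod_expr_block (fun j => (M j)%:R) (hp a ap)).
have diff : `|\sum_(a <- msupp p) p@_a * \prod_i P a i -
              \sum_(a <- msupp p) p@_a * \prod_i y i ^+ a i| <= C / N%:R.
  rewrite -sumrB; apply: le_trans (ler_norm_sum _ _ _) _.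
  rewrite /C mulr_suml; apply: ler_sum => a _.
  rewrite -mulrBr normrM -mulrA; apply: ler_wpM2l => //.
  have P01 i : 0 <= P a i <= 1 by case: (ffact_ratio_bound R (a i) (M0 (B i)) (mM i)).
  have y01 i : 0 <= y i ^+ a i <= 1.
    by rewrite exprn_ge0 // exprn_ile1 // ler_pdivrMr // mul1r ler_nat.
  apply: le_trans (ler_normB_prod _ P01 y01) _.
  rewrite mulr_suml; apply: ler_sum => i _.
  case: (ffact_ratio_bound R (a i) (M0 (B i)) (mM i)) => _ /le_trans; apply.
  by apply: ler_wpM2l => //; rewrite lef_pV2 ?posrE ?ltr0n // ler_nat /M leq_addr.
have CNlam : C / N%:R <= lam.
  by rewrite ler_pdivrMr ?ltr0n // mulrC -ler_pdivrMr // ltW.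
by move: diff; rewrite ler_norml => /andP[lo _]; lra.
Qed.

(** Pigeonhole in each block: at most [r] entries below [1 / (r + 1)] cannot sum to 1. *)
Lemma exists_large_transversal x :
  (forall j, \sum_(i | B i == j) x i = 1) ->
  exists2 T : {ffun 'I_k -> 'I_r}, (forall j, B (T j) = j) &
    forall j, (r.+1%:R)^-1 <= x (T j).
Proof.
move=> x1.
have large j : exists i, B i = j /\ (r.+1%:R)^-1 <= x i.
  case: (boolP [exists i, (B i == j) && ((r.+1%:R)^-1 <= x i)]).
    by case/existsP => i /andP[/eqP Bi xi]; exists i.
  move=> /existsPn small.
  have : \sum_(i | B i == j) x i <= \sum_(i : 'I_r) (r.+1%:R)^-1.
    rewrite [leRHS](bigID (fun i => B i == j)) /=.
    rewrite -[leLHS]addr0 lerD ?sumr_ge0 //; last by move=> i _; rewrite invr_ge0.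
    by apply: ler_sum => i Bi; have := small i; rewrite Bi /= -ltNge; apply: ltW.
  rewrite x1 sumr_const card_ord -[X in 1 <= X]mulr_natl ler_pdivlMr ?ltr0n //.
  by rewrite mul1r ler_nat ltnn.
have [T hT] := fin_all_exists large.
by exists (finfun T) => j; rewrite ffunE; case: (hT j).
Qed.

Lemma meval_prod_sigma x :
  (\prod_j sigma j).@[x] = \prod_j \sum_(i | B i == j) x i.
Proof.
rewrite rmorph_prod; apply: eq_bigr => j _ /=.
by rewrite /sigma raddf_sum; apply: eq_bigr => i _ /=; rewrite mevalXU.
Qed.

(* A monomial of the product that does not vanish at the vertex [T] involves only
   the variables [T j], so it bounds the product from below wherever these are
   large; on normalized points the product equals [p]. *)
Lemma meval_lower_bound p N :
  nonneg_coeffs ((\prod_j sigma j) ^+ N * p) ->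
  (forall T : {ffun 'I_k -> 'I_r}, (forall j, B (T j) = j) ->
     p.@[fun i => (i == T (B i))%:R] != 0) ->
  exists2 lam, 0 < lam & forall x, (forall i, 0 <= x i) ->
     (forall j, \sum_(i | B i == j) x i = 1) -> lam <= p.@[x].
Proof.
set P := _ * p => hP hT.
have Pp x : (forall j, \sum_(i | B i == j) x i = 1) -> P.@[x] = p.@[x].
  move=> x1; rewrite mevalM rmorphXn /= meval_prod_sigma big1 ?expr1n ?mul1r //.
have bound (T : {ffun 'I_k -> 'I_r}) : exists lam, 0 < lam /\
    forall x, (forall i, 0 <= x i) -> (forall j, B (T j) = j) ->
      (forall j, (r.+1%:R)^-1 <= x (T j)) -> lam <= P.@[x].
  (* A [T] that is not a transversal gets the dummy bound 1, so that the minimum can run over all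
     functions. *)
  have [/forallP BT|] := boolP [forall j, B (T j) == j]; last first.
    by move/forallPn => [j nBT]; exists 1; split=> // x _ BT; rewrite BT eqxx in nBT.
  have {}BT j : B (T j) = j by apply/eqP.
  have := hT T BT; rewrite -Pp => [|j]; last first.
    rewrite (bigD1 (T j)) ?BT //= eqxx big1 ?addr0 // => i /andP[/eqP <-].
    by move/negbTE ->.
  rewrite mevalE => nz.
  (* [eT m] is the value of the monomial at the vertex; it is nonzero only if all variables of [m]
     are of the form [T j]. *)
  pose eT (m : 'X_{1..r}) := \prod_i ((i == T (B i))%:R : R) ^+ m i.
  have [/hasP[m mP]|/hasPn z] := boolP (has (fun m => eT m != 0) (msupp P)); last first.
    case/negP: nz; rewrite big_seq big1 // => m /z.
    by rewrite negbK /eT => /eqP ->; rewrite mulr0.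
  move/prodf_neq0 => supp.
  have r0 : 0 < (r.+1%:R)^-1 :> R by rewrite invr_gt0 ltr0n.
  exists (P@_m * \prod_i (r.+1%:R)^-1 ^+ m i); split.
    rewrite mulr_gt0 ?prodr_gt0 // => [|i _]; last by rewrite exprn_gt0.
    by rewrite lt_def -mcoeff_msupp mP hP.
  move=> x x0 _ xT; apply: le_trans (meval_ge_term m hP x0).
  apply: ler_wpM2l; first exact: hP.
  apply: ler_prod => i _; rewrite exprn_ge0 ?(ltW r0) //=.
  have := supp i isT; have [->|mi] := posnP (m i); first by rewrite !expr0.
  case: (i =P T (B i)) => [eqi _|_]; last by rewrite expr0n gtn_eqF // eqxx.
  by apply: lerXn2r; rewrite ?nnegrE ?(ltW r0) // eqi.
have [lamT hlamT] := fin_all_exists bound.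
have [lam lam0 lamle] := exists_pos_lower_bound (fun T => proj1 (hlamT T)).
exists lam => // x x0 x1; have [T BT xT] := exists_large_transversal x1.
rewrite -Pp //; apply: le_trans (lamle T) _.
by case: (hlamT T) => _; apply.
Qed.

(** Continuity made explicit: [C] is a Lipschitz bound on the unit cube along the segment from [x]
    to the all-ones point. *)
Lemma meval_ge0_closure p :
  (forall x, (forall i, 0 < x i) -> 0 <= p.@[x]) ->
  forall x, (forall i, 0 <= x i <= 1) -> 0 <= p.@[x].
Proof.
move=> hp x x01; rewrite leNgt; apply/negP => px.
pose C := \sum_(m <- msupp p) `|p@_m| * \sum_i (m i)%:R.
have C0 : 0 <= C by apply: sumr_ge0 => m _; rewrite mulr_ge0 // sumr_ge0.
(* Chosen so that [t < 1] and [C * t < - p.@[x]]; the summand 1 makes both strict. *)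
pose t := - p.@[x] / (C - p.@[x] + 1).
have den : 0 < C - p.@[x] + 1 by lra.
have t0 : 0 < t by rewrite divr_gt0 //; lra.
have t1 : t < 1 by rewrite ltr_pdivrMr // mul1r; lra.
pose y i := (1 - t) * x i + t.
have y01 i : 0 < y i <= 1.
  rewrite /y; have /andP[x0 x1] := x01 i.
  by apply/andP; split; nra.
have : p.@[y] - p.@[x] <= C * t.
  apply: le_trans (ler_norm _) _.
  rewrite !mevalE -sumrB; apply: le_trans (ler_norm_sum _ _ _) _.
  rewrite /C mulr_suml; apply: ler_sum => m _.
  rewrite -mulrBr normrM -mulrA; apply: ler_wpM2l => //.
  apply: le_trans (ler_normB_prod _ _ _) _ => [i|i|].
  - by have /andP[/ltW y0 y1] := y01 i; rewrite exprn_ge0 // exprn_ile1.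
  - by have /andP[x0 x1] := x01 i; rewrite exprn_ge0 // exprn_ile1.
  rewrite mulr_suml; apply: ler_sum => i _.
  have /andP[/ltW y0 y1] := y01 i.
  apply: le_trans (ler_normB_pow _ _ (x01 i)) _; first by rewrite y0.
  apply: ler_wpM2l => //; rewrite /y.
  have -> : (1 - t) * x i + t - x i = t * (1 - x i) by ring.
  have /andP[x0 x1] := x01 i.
  by rewrite ger0_norm; nra.
have := hp y (fun i => proj1 (andP (y01 i))).
have Ct : C * t < - p.@[x].
  by rewrite /t mulrA ltr_pdivrMr //; nra.
by lra.
Qed.

End Blocks.

(** * Uniqueness of the facet description *)

Section FacetUniqueness.
Variables (R : realFieldType) (V : lmodType R).

Definition affine_map (f : V -> R) :=
  forall x y z t, f (x + t *: (y - z)) = f x + t * (f y - f z).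

Definition irredundant (I : finType) (f : I -> V -> R) :=
  forall i, exists x, (forall j, j != i -> 0 <= f j x) /\ f i x < 0.

(** Finitely many strict inequalities survive a small move: [t = e / S], with [e] below all [a i]
    and [S] above all [|b i|]. *)
Lemma small_step_pos (I : finType) (a b : I -> R) :
  (forall i, 0 < a i) -> exists2 t, 0 < t & forall i, 0 < a i + t * b i.
Proof.
move=> a0; have [e e0 ea] := exists_pos_lower_bound a0.
pose S := \sum_i `|b i| + 1.
have S0 : 0 < S by rewrite ltr_wpDl // sumr_ge0.
have bS i : `|b i| < S by rewrite /S (bigD1 i) //= -addrA ltrDl ltr_wpDl // sumr_ge0.
exists (e / S); first by rewrite divr_gt0.
move=> i; rewrite -ltrBlDr sub0r.
apply: lt_le_trans (_ : e <= _); last exact: ea.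
apply: le_lt_trans (_ : e / S * `|b i| < _).
  rewrite -mulrN; apply: ler_wpM2l; first by rewrite divr_ge0 ?ltW.
  by rewrite -normrN ler_norm.
by rewrite mulrAC ltr_pdivrMr // ltr_pM2l.
Qed.

(** If [f i p] were 0, a short step towards a point violating only [f i] would leave the
    polyhedron. *)
Lemma irredundant_gt0 (I : finType) (f : I -> V -> R) (p : V) :
  (forall i, affine_map (f i)) -> irredundant f -> (forall i, 0 <= f i p) ->
  (forall v, exists2 t, 0 < t & forall i, 0 <= f i (p + t *: (v - p))) ->
  forall i, 0 < f i p.
Proof.
move=> af irr fp inner i; have [x [_ fx]] := irr i; have fip := fp i.
have [t t0 /(_ i)] := inner x.
rewrite af; nra.
Qed.

(* The facet [f i = 0] has a point [z] at which all other [f j] are positive; some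
   [g s] must vanish there, and [f i >= 0] implies [g s >= 0]. *)
Lemma facet_unique (I J : finType) (f : I -> V -> R) (g : J -> V -> R) (p : V) :
  (forall i, affine_map (f i)) -> (forall j, affine_map (g j)) ->
  (forall x, (forall i, 0 <= f i x) <-> (forall j, 0 <= g j x)) ->
  (forall i, 0 < f i p) -> (forall j, 0 < g j p) -> irredundant f ->
  forall i, exists j, exists2 lam, 0 < lam & forall x, g j x = lam * f i x.
Proof.
move=> af ag fg fp gp irr i; have [xi [xi_ge xi_lt]] := irr i.
(* The segment from [p] to [xi] meets the hyperplane [f i = 0] at this parameter. *)
pose t := f i p / (f i p - f i xi).
have fip := fp i; have den : 0 < f i p - f i xi by lra.
have t0 : 0 < t by rewrite divr_gt0.
have t1 : t < 1 by rewrite ltr_pdivrMr // mul1r; lra.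
pose z := p + t *: (xi - p).
have fiz : f i z = 0.
  by rewrite /z af -[f i xi - _]opprB mulrN /t divfK ?subrr // gt_eqF.
have fjz j : j != i -> 0 < f j z.
  by move=> ji; rewrite /z af; have := xi_ge j ji; have := fp j; nra.
have zin : forall j, 0 <= g j z.
  apply/fg => j; have [->|/fjz/ltW//] := eqVneq j i; by rewrite fiz.
(* Otherwise a short step from [z] away from [p] keeps every [g j] nonnegative but makes [f i]
   negative. *)
have [j gjz] : exists j, g j z = 0.
  case: (boolP [exists j, g j z == 0]) => [/existsP[j /eqP]|/existsPn nz]; first by exists j.
  have gz j : 0 < g j z by rewrite lt_def nz zin.
  have [e e0 he] := small_step_pos (fun j => g j z - g j p) gz.
  have : forall i, 0 <= f i (z + e *: (z - p)).
    by apply/fg => j; rewrite ag ltW.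
  by move/(_ i); rewrite af fiz; nra.
exists j.
(* Near [z] only [f i] constrains the polyhedron, so a short step from [z] towards [y] stays inside;
   [g j z = 0] then gives the sign of [g j y]. *)
have impl y : 0 <= f i y -> 0 <= g j y.
  move=> fy.
  have pos l : 0 < (if l == i then 1 else f l z).
    by have [_|/fjz//] := eqVneq l i; apply: ltr01.
  have [e e0 he] := small_step_pos (fun l => f l y - f l z) pos.
  have : forall j, 0 <= g j (z + e *: (y - z)).
    apply/fg => l; rewrite af; have := he l.
    by case: eqP => [-> _|_ /ltW//]; rewrite fiz add0r subr0 mulr_ge0 // ltW.
  by move/(_ j); rewrite ag gjz add0r subr0 pmulr_rge0.
(* Translate [y] along [p - z] onto the hyperplane [f i = 0] and apply [impl]. *)
have half y : (g j p / f i p) * f i y <= g j y.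
  have fw : 0 <= f i (y + (- (f i y / f i p)) *: (p - z)).
    by rewrite af fiz subr0 mulNr divfK ?subrr // gt_eqF.
  have := impl _ fw; rewrite ag gjz subr0 mulNr subr_ge0; congr (is_true (_ <= _)).
  by ring.
exists (g j p / f i p) => [|y]; first by rewrite divr_gt0.
(* The opposite inequality is [half] at the reflection of [y] through [z]. *)
apply/eqP; rewrite eq_le half andbT.
have := half (z + (-1) *: (y - z)).
by rewrite af ag fiz gjz !subr0 !add0r !mulN1r mulrN lerN2.
Qed.

End FacetUniqueness.

(** * Facets of a product of simplices and their matching with the Cox data *)

Definition prod_simplex_facet (R : pzRingType) (n k : nat) (blk : 'I_n -> 'I_k)
    (d : 'I_k -> nat) (s : 'I_n + 'I_k) (x : 'rV[R]_n) : R :=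
  match s with
  | inl m => x 0 m
  | inr j => (d j)%:R - \sum_(m | blk m == j) x 0 m
  end.

Section FacetMatching.
Variables (R : realType) (n k : nat) (blk : 'I_n -> 'I_k) (d : 'I_k -> nat).
Hypothesis blk_surj : forall j, exists m, blk m = j.
Hypothesis d_gt0 : forall j, (0 < d j)%N.

Local Notation std := (@prod_simplex_facet R n k blk d).

Lemma prod_simplex_facet_affine s : affine_map (std s).
Proof.
move=> x y z t; case: s => [m|j] /=; first by rewrite !mxE.
under eq_bigr => m _ do rewrite !mxE.
rewrite big_split /= -mulr_sumr sumrB; ring.
Qed.

Lemma prod_simplex_facet_irredundant : irredundant std.
Proof.
case=> [m|j].
  (* Only the coordinate facet [m] is violated at minus the unit vector. *)
  exists (- delta_mx 0 m); rewrite /= !mxE !eqxx ltrN10; split=> //.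
  case=> [m'|j] /=.
    by rewrite !mxE eqxx /=; case: (m' =P m) => [->|]; rewrite ?eqxx ?oppr0.
  move=> _; under eq_bigr do rewrite !mxE.
  by rewrite sumrN opprK addr_ge0 // sumr_ge0.
have [m bm] := blk_surj j.
(* The point [a] times a unit vector of block [j] exceeds the sum bound of that block only. *)
pose a : R := (d j)%:R + 1.
have a0 : 0 <= a by rewrite addr_ge0.
have sumE j' : \sum_(m' | blk m' == j') (a *: delta_mx 0 m : 'rV[R]_n) 0 m' =
    if j == j' then a else 0.
  case: eqP => [<-|njj'].
    rewrite (bigD1 m) ?bm //= !mxE !eqxx mulr1 big1 ?addr0 // => m' /andP[_ /negbTE nm].
    by rewrite !mxE nm andbF mulr0.
  rewrite big1 // => m' /eqP bm'; rewrite !mxE.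
  by case: (m' =P m) => [eqm|]; [case: njj'; rewrite -bm -bm' eqm | rewrite andbF mulr0].
exists (a *: delta_mx 0 m); split; last by rewrite /= sumE eqxx /a; lra.
case=> [m'|j'] /=; first by rewrite !mxE mulr_ge0.
by rewrite sumE; case: (j =P j') => [->|_]; rewrite ?eqxx ?subr0.
Qed.

Lemma facet_val_affine r (F : 'M[int]_(n, r)) (b : 'rV[int]_r) i :
  affine_map (fun x : 'rV[R]_n => facet_val F b x i).
Proof.
move=> x y z t; rewrite /facet_val mulmxDl -scalemxAl mulmxBl !mxE; ring.
Qed.

(** All nonzero entries of [v] have the same absolute value [1 / lam], which then divides the gcd
    1. *)
Lemma primitive_scale (I : finType) (v : I -> int) (c : I -> R) (lam : R) :
  (\big[gcdn/0%N]_l `|v l|)%N = 1%N -> 0 < lam ->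
  (forall l, (lam * (v l)%:~R = c l)) -> (forall l, c l = 0 \/ `|c l| = 1) ->
  (exists l, c l != 0) -> lam = 1.
Proof.
move=> gcd1 lam0 hv hc [l0 c0].
have cl0 : `|c l0| = 1 by case: (hc l0) c0 => [->|]; rewrite ?eqxx.
have nv l : lam * (`|v l|%N)%:R = `|c l|.
  by rewrite -hv normrM (gtr0_norm lam0) -intr_norm -abszE.
have : (`|v l0| %| \big[gcdn/0%N]_l `|v l|)%N.
  apply/dvdn_biggcdP => l _; case: (hc l) => cl.
    move: (nv l); rewrite cl normr0 => /eqP.
    by rewrite mulf_eq0 gt_eqF //= pnatr_eq0 => /eqP ->.
  have : lam * (`|v l|%N)%:R = lam * (`|v l0|%N)%:R by rewrite !nv cl cl0.
  by move/(mulfI (lt0r_neq0 lam0))/eqP; rewrite eqr_nat => /eqP ->.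
rewrite gcd1 dvdn1 => /eqP v1.
by have := nv l0; rewrite v1 mulr1 cl0.
Qed.

(** [facet_unique] is applied in both directions; primitivity of the normals forces the scaling
    factor to be 1. *)
Lemma facet_matching r (F : 'M[int]_(n, r)) (b : 'rV[int]_r) :
  (forall x : 'rV[R]_n, (forall s, 0 <= std s x) <-> (forall i, 0 <= facet_val F b x i)) ->
  (forall i, (\big[gcdn/0%N]_(l < n) `|F l i|)%N = 1%N) ->
  irredundant (fun i (x : 'rV[R]_n) => facet_val F b x i) ->
  exists phi : 'I_r -> 'I_n + 'I_k, exists2 psi, cancel phi psi /\ cancel psi phi &
    forall i x, facet_val F b x i = std (phi i) x.
Proof.
move=> desc prim irr; pose f i (x : 'rV[R]_n) := facet_val F b x i.
(* An interior point: each block sum is at most [n / (n + 1)], hence below [1 <= d j]. *)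
pose p : 'rV[R]_n := const_mx (n.+1%:R)^-1.
have n0 : 0 < (n.+1%:R)^-1 :> R by rewrite invr_gt0.
have stdp s : 0 < std s p.
  case: s => [m|j] /=; first by rewrite mxE.
  rewrite subr_gt0; apply: lt_le_trans (_ : 1 <= _); last by rewrite ler1n.
  under eq_bigr do rewrite mxE.
  rewrite sumr_const -[X in X < _]mulr_natl ltr_pdivrMr // mul1r ltr_nat ltnS.
  by rewrite -[leqRHS]card_ord max_card.
have fp i : 0 < f i p.
  apply: irredundant_gt0 (i) => //; first by move=> l; apply: facet_val_affine.
    by apply/desc => s; apply: ltW.
  move=> v; have [t t0 ht] := small_step_pos (fun s => std s v - std s p) stdp.
  exists t => //; apply/desc => s; rewrite prod_simplex_facet_affine; exact: ltW.
have desc' x : (forall i, 0 <= f i x) <-> (forall s, 0 <= std s x).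
  by split=> /desc.
have f_aff i : affine_map (f i) by apply: facet_val_affine.
have phi_ex i : exists s, forall x, f i x = std s x.
  have [s [lam lam0 eqs]] := facet_unique f_aff prod_simplex_facet_affine desc' fp stdp irr i.
  exists s => x; rewrite eqs.
  suff -> : lam = 1 by rewrite mul1r.
  (* The linear coefficients of [std s], all in [{0, 1, -1}]. *)
  pose c l := std s (delta_mx 0 l) - std s 0.
  have std0 : std s 0 = match s with inl _ => 0 | inr j => (d j)%:R end.
    by case: (s) => [m|j] /=; rewrite ?mxE // big1 ?subr0 // => m; rewrite mxE.
  have cE l : c l = match s with inl m => (m == l)%:R | inr j => - (blk l == j)%:R end.
    rewrite /c std0; case: (s) => [m|j] /=; first by rewrite !mxE eqxx subr0.
    rewrite addrAC subrr add0r; congr (- _).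
    have [bl|nbl] := eqVneq (blk l) j.
      rewrite (bigD1 l) ?bl //= !mxE !eqxx big1 ?addr0 // => m' /andP[_ /negbTE nm].
      by rewrite !mxE nm andbF.
    rewrite big1 // => m' /eqP bm'; rewrite !mxE.
    by case: (m' =P l) nbl => [<-|]; rewrite ?andbF // bm' eqxx.
  apply: (primitive_scale (c := c) (prim i)) => // [l|l|].
  - rewrite /c !eqs -mulrBr /f /facet_val !mul0mx !mxE add0r addrK; congr (_ * _).
    rewrite (bigD1 l) //= !mxE !eqxx mul1r big1 ?addr0 // => m /negbTE nm.
    by rewrite !mxE nm andbF mul0r.
  - rewrite cE; case: (s) => [m|j]; case: eqP => _; rewrite ?oppr0 ?normrN ?normr1;
      by [left | right].
  - case: (s) cE => [m|j] cE; first by exists m; rewrite cE eqxx oner_neq0.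
    by have [m bm] := blk_surj j; exists m; rewrite cE bm eqxx oppr_eq0 oner_neq0.
have [phi phiE] := fin_all_exists phi_ex.
have psi_ex s : exists i, phi i = s.
  have [i [lam lam0 eqi]] := facet_unique prod_simplex_facet_affine f_aff
    (fun x => iff_sym (desc' x)) stdp fp prod_simplex_facet_irredundant s.
  exists i; apply/eqP/contraT => ne.
  have [x [xge xlt]] := prod_simplex_facet_irredundant s.
  have := xge _ ne; rewrite -phiE eqi pmulr_rge0 //.
  by rewrite leNgt xlt.
have [psi psiK] := fin_all_exists psi_ex.
exists phi, psi => //; split=> // i.
(* Two distinct rays with the same facet function would contradict irredundancy. *)
apply/eqP/contraT => ne; have [x [xge xlt]] := irr i.
by have := xge _ ne; rewrite [facet_val _ _ _ _]phiE psiK -phiE leNgt xlt.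
Qed.

End FacetMatching.

(** * Convex hulls and the inequalities of a product of simplices *)

Lemma big_option (M : nmodType) (I : finType) (G : option I -> M) :
  \sum_o G o = G None + \sum_i G (Some i).
Proof.
rewrite (bigD1 None) //=; congr (_ + _).
rewrite (reindex_omap Some id) => [|[]] //=.
by apply: eq_bigl => i; rewrite eqxx.
Qed.

Section Convexity.
Variable R : realType.

(** [in_conv] indexes weights by list positions; this form allows any finite index type with
    repetitions, merging weights at equal positions. *)
Lemma in_conv_family (m : nat) (S : seq 'rV[R]_m) (I : finType) (w : I -> R)
    (p : I -> 'rV[R]_m) :
  (forall i, 0 <= w i) -> \sum_i w i = 1 -> (forall i, p i \in S) ->
  in_conv S (\sum_i w i *: p i).
Proof.
move=> w0 w1 pS.
have lt_idx i : (index (p i) S < size S)%N by rewrite index_mem.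
pose idx i := Ordinal (lt_idx i).
exists (fun l => \sum_(i | idx i == l) w i); split.
- by move=> l; apply: sumr_ge0.
- by rewrite -w1 [RHS](partition_big idx predT).
- rewrite (partition_big idx predT) //=; apply: eq_bigr => l _.
  rewrite scaler_suml; apply: eq_bigr => i /eqP <- /=.
  by rewrite nth_index.
Qed.

Lemma in_conv_sub (m : nat) (S S' : seq 'rV[R]_m) x :
  {subset S <= S'} -> in_conv S x -> in_conv S' x.
Proof.
move=> sSS' [w [w0 w1 ->]]; apply: in_conv_family => // i.
by apply/sSS'/mem_nth.
Qed.

Lemma in_conv_mem (m : nat) (S : seq 'rV[R]_m) x : x \in S -> in_conv S x.
Proof.
move=> xS; have := @in_conv_family _ S 'I_1 (fun=> 1) (fun=> x).
by rewrite !big_ord1 scale1r; apply.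
Qed.

Lemma in_conv_simplex (m d : nat) (y : 'rV[R]_m) : (0 < d)%N ->
  in_conv (simplex_pts R m d) y <->
  (forall l, 0 <= y 0 l) /\ \sum_l y 0 l <= d%:R.
Proof.
move=> d0; have d0R : 0 < d%:R :> R by rewrite ltr0n.
split=> [[w [w0 w1 ->]]|[y0 yd]].
  have pts (s : 'rV[R]_m) : s \in simplex_pts R m d ->
      (forall l, 0 <= s 0 l) /\ \sum_l s 0 l <= d%:R.
    rewrite inE => /orP[/eqP ->|/mapP[l0 _ ->]].
      by split=> [l|]; [rewrite mxE | rewrite big1 // => l _; rewrite mxE].
    split=> [l|]; first by rewrite !mxE mulr_ge0.
    rewrite (bigD1 l0) //= big1 ?addr0 => [|l /negbTE nl]; last by rewrite !mxE nl andbF mulr0.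
    by rewrite !mxE !eqxx mulr1.
  have {}pts i := pts _ (mem_nth 0 (ltn_ord i)).
  split=> [l|].
    rewrite summxE; apply: sumr_ge0 => i _; rewrite !mxE mulr_ge0 //.
    by case: (pts i).
  under eq_bigr do rewrite summxE.
  have -> : d%:R = \sum_i w i * d%:R by rewrite -mulr_suml w1 mul1r.
  rewrite exchange_big /=; apply: ler_sum => i _.
  under eq_bigr do rewrite mxE.
  by rewrite -mulr_sumr; apply: ler_wpM2l => //; case: (pts i).
(* [Some l] carries the weight of the vertex on axis [l]; [None] gives the origin what is left. *)
pose w (o : option 'I_m) := if o is Some l then y 0 l / d%:R else 1 - (\sum_l y 0 l) / d%:R.
pose p (o : option 'I_m) : 'rV[R]_m := if o is Some l then d%:R *: delta_mx 0 l else 0.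
have -> : y = \sum_o w o *: p o.
  rewrite big_option /= scaler0 add0r [LHS]row_sum_delta; apply: eq_bigr => l _.
  by rewrite scalerA divfK // gt_eqF.
apply: in_conv_family.
- case=> [l|] /=; first by rewrite divr_ge0.
  by rewrite subr_ge0 ler_pdivrMr // mul1r.
- by rewrite big_option /= mulr_suml subrK.
- case=> [l|]; rewrite inE ?eqxx //; apply/orP; right; apply/mapP.
  by exists l => //; rewrite mem_enum.
Qed.

Lemma in_conv_prod_simplex (k : nat) (ns ds : 'I_k -> nat)
    (x : 'rV[R]_(\sum_(j < k) ns j)%N) :
  (forall j, (0 < ds j)%N) ->
  (forall j, in_conv (simplex_pts R (ns j) (ds j)) (blockv ns x j)) <->
  (forall s, 0 <= prod_simplex_facet (@tagnat.sig1 k ns) ds s x).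
Proof.
move=> d0.
have blockE j l : blockv ns x j 0 l = x 0 (tagnat.Rank j l).
  rewrite mxE /coordf (big_pred1 (tagnat.Rank j l)) // => i.
  by rewrite -[RHS]val_eqE [X in _ = (_ == X)]tagnat.RankEsum.
have sumE j : \sum_l blockv ns x j 0 l = \sum_(m | tagnat.sig1 m == j) x 0 m.
  rewrite (reindex _ (onW_bij _ (@tagnat.rank_bij k ns))) /=.
  under eq_bigr do rewrite blockE.
  rewrite -(big_pred1_eq (@GRing.add R) j (fun j => \sum_l x 0 (tagnat.Rank j l))).
  rewrite sig_big_dep /=; apply: eq_big => [p|p _]; last by rewrite tagnat.rankE.
  by rewrite andbT tagnat.rankE tagnat.Rank1K.
split=> [h [m|j] /=|h j].
- have [/(_ (tagnat.sig2 m)) + _] := (in_conv_simplex _ (d0 _)).1 (h (tagnat.sig1 m)).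
  by rewrite blockE tagnat.sig2K.
- have [_] := (in_conv_simplex _ (d0 _)).1 (h j).
  by rewrite sumE subr_ge0.
- apply/in_conv_simplex => //; split=> [l|].
    by rewrite blockE; apply: (h (inl _)).
  by rewrite sumE -subr_ge0; apply: (h (inr _)).
Qed.

End Convexity.

(** * Vertices, maximal cones and primitive collections *)

Section Polytope.
Variables (R : realType) (n k r : nat) (blk : 'I_n -> 'I_k) (d : 'I_k -> nat).
Variables (A : seq 'rV[int]_n) (F : 'M[int]_(n, r)) (b : 'rV[int]_r).
Variables (phi : 'I_r -> 'I_n + 'I_k) (psi : 'I_n + 'I_k -> 'I_r).
Hypothesis d_gt0 : forall j, (0 < d j)%N.
Hypothesis convA : forall x : 'rV[R]_n,
  in_conv (map (@intvec R n) A) x <-> (forall i, 0 <= facet_val F b x i).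
Hypothesis phiK : cancel phi psi.
Hypothesis psiK : cancel psi phi.
Hypothesis facetE : forall i (x : 'rV[R]_n),
  facet_val F b x i = prod_simplex_facet blk d (phi i) x.

Definition ray_block (i : 'I_r) : 'I_k :=
  match phi i with inl m => blk m | inr j => j end.
Local Notation B := ray_block.

(* The vertices of a product of simplices, hence the maximal cones of its normal
   fan, correspond to the choice in every block of the one ray [T j] that is not
   in the cone. *)
Definition transversal_map (T : {ffun 'I_k -> 'I_r}) : bool :=
  [forall j, B (T j) == j].

Lemma transversal_mapP (T : {ffun 'I_k -> 'I_r}) :
  reflect (forall j, B (T j) = j) (transversal_map T).
Proof. by apply: (iffP forallP) => h j; apply/eqP. Qed.

Lemma big_rays (S : Type) (idx : S) (op : Monoid.com_law idx) (P : pred 'I_r) G :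
  \big[op/idx]_(i | P i) G i =
  op (\big[op/idx]_(m | P (psi (inl m))) G (psi (inl m)))
     (\big[op/idx]_(j | P (psi (inr j))) G (psi (inr j))).
Proof.
rewrite (reindex psi); last by apply: onW_bij; exists phi.
by rewrite big_sumType.
Qed.

Lemma ray_block_inl m : B (psi (inl m)) = blk m. Proof. by rewrite /B psiK. Qed.
Lemma ray_block_inr j : B (psi (inr j)) = j. Proof. by rewrite /B psiK. Qed.

(** The coordinates of block [j] cancel against its sum facet. This is the source of the block
    homogeneity of [fcox]. *)
Lemma sum_facet_val (x : 'rV[R]_n) j : \sum_(i | B i == j) facet_val F b x i = (d j)%:R.
Proof.
rewrite big_rays /=.
under eq_bigl do rewrite ray_block_inl.
under [X in _ + X]eq_bigl do rewrite ray_block_inr.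
rewrite big_pred1_eq facetE psiK /= addrC -[RHS](subrK (\sum_(m | blk m == j) x 0 m)).
by congr (_ + _); apply: eq_bigr => m _; rewrite facetE psiK.
Qed.

Lemma facet_val_inj (x y : 'rV[R]_n) :
  (forall i, facet_val F b x i = facet_val F b y i) -> x = y.
Proof.
move=> h; apply/rowP => m.
by have := h (psi (inl m)); rewrite !facetE psiK.
Qed.

Lemma intvec_inj : injective (@intvec R n).
Proof. by move=> u v /rowP uv; apply/rowP => m; have := uv m; rewrite !mxE => /intr_inj. Qed.

Lemma facet_val_intvec a i :
  facet_val F b (intvec R a) i = ((a *m F) 0 i + b 0 i)%:~R.
Proof. by rewrite /facet_val /intvec -map_mxM mxE rmorphD. Qed.

Lemma facet_val_ge0 a i : a \in A -> 0 <= facet_val F b (intvec R a) i.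
Proof. by move=> aA; move: i; apply/convA/in_conv_mem/map_f. Qed.

Lemma cox_expE a i : a \in A -> (cox_exp F b a i)%:R = facet_val F b (intvec R a) i.
Proof.
move=> aA; have := facet_val_ge0 i aA; rewrite facet_val_intvec ler0z /cox_exp.
by case: (_ + _).
Qed.

Lemma sum_cox_exp a j : a \in A -> (\sum_(i | B i == j) cox_exp F b a i)%N = d j.
Proof.
move=> aA; apply/eqP; rewrite -(eqr_nat R) natr_sum; apply/eqP.
by under eq_bigr do rewrite cox_expE //; apply: sum_facet_val.
Qed.

(** If [T j] is a coordinate ray, block [j] of the vertex is [d j] times that unit vector; if it is
    the sum ray, the block is 0. *)
Definition vertex_of (T : {ffun 'I_k -> 'I_r}) : 'rV[int]_n :=
  \row_m (if T (blk m) == psi (inl m) then (d (blk m))%:Z else 0).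

Lemma facet_val_vertex T i : transversal_map T ->
  facet_val F b (intvec R (vertex_of T)) i = if i == T (B i) then (d (B i))%:R else 0.
Proof.
move=> /transversal_mapP BT; rewrite facetE -{2 3 4}(phiK i).
case: (phi i) => [m|j] /=.
  by rewrite !mxE ray_block_inl eq_sym; case: ifP.
rewrite ray_block_inr.
have -> : \sum_(m | blk m == j) intvec R (vertex_of T) 0 m =
    \sum_(m | (blk m == j) && (T j == psi (inl m))) (d j)%:R.
  by rewrite big_mkcondr; apply: eq_bigr => m /eqP bm; rewrite !mxE bm; case: ifP.
case: ifPn => [/eqP <-|nT].
  by rewrite big1 ?subr0 // => m /andP[_ /eqP/(can_inj psiK)].
case phiT : (phi (T j)) => [m|j'].
  have bm : blk m = j by rewrite -[RHS](BT j) /B phiT.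
  rewrite (big_pred1 m) ?subrr // => m' /=.
  rewrite -(phiK (T j)) phiT (can_eq psiK).
  by apply/andP/eqP => [[_ /eqP[->]]|->] //; rewrite bm !eqxx.
have jj' : j' = j by rewrite -[RHS](BT j) /B phiT.
by case/eqP: nT; rewrite -jj' -phiT phiK jj'.
Qed.

(* A point of a product of simplices is the combination of the vertices
   [vertex_of T] with weights [\prod_j facet_val x (T j) / d j]. *)
Lemma in_conv_vertices (S : seq 'rV[R]_n) (x : 'rV[R]_n) :
  (forall T, transversal_map T -> intvec R (vertex_of T) \in S) ->
  (forall i, 0 <= facet_val F b x i) -> in_conv S x.
Proof.
move=> hS x0.
have d0R j : (d j)%:R != 0 :> R by rewrite pnatr_eq0 -lt0n.
pose T0 := [ffun j => psi (inr j)].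
have T0P : transversal_map T0 by apply/transversal_mapP => j; rewrite ffunE ray_block_inr.
(* A probability distribution on the rays of block [j]; [w] is the product distribution. *)
pose g j i : R := if B i == j then facet_val F b x i / (d j)%:R else 0.
have g1 j : \sum_i g j i = 1.
  by rewrite -big_mkcond -mulr_suml sum_facet_val divff.
pose w (T : {ffun 'I_k -> 'I_r}) : R := \prod_j g j (T j).
pose p T := intvec R (vertex_of (if transversal_map T then T else T0)).
have w0 T : 0 <= w T.
  by apply: prodr_ge0 => j _; rewrite /g; case: ifP => // _; rewrite divr_ge0.
have w1 : \sum_T w T = 1.
  by rewrite -bigA_distr_bigA big1.
have wT T : ~~ transversal_map T -> w T = 0.
  by move/forallPn => [j /negbTE nj]; rewrite /w (bigD1 j) //= /g nj mul0r.
have -> : x = \sum_T w T *: p T.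
  apply: facet_val_inj => i.
  have -> : facet_val F b (\sum_T w T *: p T) i = \sum_T w T * facet_val F b (p T) i.
    rewrite /facet_val mulmx_suml summxE -[X in _ + X]mul1r -w1 mulr_suml -big_split.
    by apply: eq_bigr => T _; rewrite -scalemxAl mxE mulrDr.
  (* The indicator of [T (B i) = i] is absorbed into factor [B i], so the sum over [T] again factors
     over the blocks. *)
  pose G j i' := g j i' * (if j == B i then (i' == i)%:R else 1).
  have step T : w T * facet_val F b (p T) i = (d (B i))%:R * \prod_j G j (T j).
    have -> : \prod_j G j (T j) = w T * (T (B i) == i)%:R.
      rewrite /G big_split /=; congr (_ * _).
      by rewrite (bigD1 (B i)) //= eqxx big1 ?mulr1 // => j /negbTE ->.
    have [TT|/wT ->] := boolP (transversal_map T); last by rewrite !mul0r mulr0.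
    rewrite /p TT facet_val_vertex // eq_sym; case: ifP => _; rewrite ?mulr0 ?mulr1 //.
    by rewrite mulrC.
  under eq_bigr do rewrite step.
  rewrite -mulr_sumr -bigA_distr_bigA (bigD1 (B i)) //= [X in _ * (_ * X)]big1 => [|j /negbTE nj].
    rewrite mulr1 (bigD1 i) //= big1 => [|i' /negbTE ni]; last by rewrite /G eqxx ni mulr0.
    by rewrite addr0 /G /g !eqxx mulr1 mulrC divfK.
  by rewrite -[RHS](g1 j); apply: eq_bigr => i' _; rewrite /G nj mulr1.
apply: in_conv_family => // T; apply: hS.
by case: ifP => // /negbT.
Qed.

(** A point of [S] with nonzero weight lies on every facet through the vertex, and the block sums
    then fix its remaining facet values. *)
Lemma vertex_of_extreme (S : seq 'rV[int]_n) T :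
  transversal_map T -> {subset S <= A} ->
  in_conv (map (@intvec R n) S) (intvec R (vertex_of T)) -> vertex_of T \in S.
Proof.
move=> TT SA [w [w0 w1 eqv]].
have [l wl] : exists l, w l != 0.
  apply/existsP; apply: contraT => /existsPn z.
  have := oner_neq0 R; rewrite -w1 big1 ?eqxx // => l _.
  by apply/eqP/negPn.
have lS : (l < size S)%N by rewrite -(size_map (@intvec R n)).
have nthE (l' : 'I_(size (map (@intvec R n) S))) :
    (map (@intvec R n) S)`_l' = intvec R S`_l'.
  by rewrite (nth_map 0) // -(size_map (@intvec R n)).
have inA (l' : 'I_(size (map (@intvec R n) S))) : S`_l' \in A.
  by apply/SA/mem_nth; rewrite -(size_map (@intvec R n)).
have zero i : i != T (B i) -> facet_val F b (intvec R S`_l) i = 0.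
  move=> nT; have := facet_val_vertex i TT; rewrite (negbTE nT) eqv.
  have -> : facet_val F b (\sum_i0 w i0 *: (map (@intvec R n) S)`_i0) i =
      \sum_l' w l' * facet_val F b (intvec R S`_l') i.
    rewrite /facet_val mulmx_suml summxE -[X in _ + X]mul1r -w1 mulr_suml -big_split.
    by apply: eq_bigr => l' _; rewrite -scalemxAl mxE mulrDr nthE.
  move/eqP; rewrite psumr_eq0 => [/allP /(_ l)|l' _]; last first.
    by rewrite mulr_ge0 // facet_val_ge0.
  by rewrite mem_index_enum mulf_eq0 (negbTE wl) => /(_ isT) /eqP.
suff -> : vertex_of T = S`_l by apply: mem_nth.
apply/intvec_inj/facet_val_inj => i; rewrite facet_val_vertex //.
case: eqP => [iT|/eqP/zero//].
rewrite -(sum_facet_val (intvec R S`_l) (B i)) (bigD1 i) //= big1 ?addr0 //.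
by move=> i' /andP[/eqP Bi' ne]; apply: zero; rewrite Bi' -iT.
Qed.

Lemma vertex_of_in T : transversal_map T -> vertex_of T \in A.
Proof.
move=> TT; apply: vertex_of_extreme => //; apply/convA => i.
by rewrite facet_val_vertex //; case: ifP.
Qed.

(** If [v] is no [vertex_of T], deleting it from [A] keeps all of these, and their hull still
    contains [v]. *)
Lemma is_vertexP v :
  is_vertex R A v <-> exists2 T, transversal_map T & v = vertex_of T.
Proof.
split=> [[vA nv]|[T TT ->]].
  case: (boolP [exists T, transversal_map T && (v == vertex_of T)]).
    by case/existsP => T /andP[TT /eqP ->]; exists T.
  move=> /existsPn neT; case: nv; apply: in_conv_vertices; last first.
    by move=> i; apply: facet_val_ge0.
  move=> T TT; apply: map_f; rewrite mem_filter vertex_of_in // andbT.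
  by have := neT T; rewrite TT eq_sym.
split=> [|h]; first exact: vertex_of_in.
have := vertex_of_extreme TT _ h; rewrite mem_filter eqxx /= => H.
by have: false by apply: H => a; rewrite mem_filter => /andP[].
Qed.

Lemma is_maxconeP sg : is_maxcone R A F b sg <->
  exists2 T, transversal_map T & sg = [set i | i != T (B i)].
Proof.
have eqS T : transversal_map T ->
   [set i : 'I_r | ((vertex_of T *m F) 0 i + b 0 i == 0)%R] = [set i | i != T (B i)].
  move=> TT; apply/setP => i; rewrite !inE -(intr_eq0 R) -facet_val_intvec facet_val_vertex //.
  by case: (i =P T (B i)) => _; rewrite ?eqxx // pnatr_eq0 eqn0Ngt d_gt0.
split=> [[v [/is_vertexP[T TT ->] ->]]|[T TT ->]].
  by exists T => //; apply: eqS.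
exists (vertex_of T); rewrite eqS //; split=> //.
by apply/is_vertexP; exists T.
Qed.

Lemma newt_eq_convP (c : 'rV[int]_n -> R) :
  newt_eq_conv A c <-> forall T, transversal_map T -> c (vertex_of T) != 0.
Proof.
split=> [newt T TT|cT x].
  have := vertex_of_extreme (S := [seq a <- A | c a != 0]) TT.
  rewrite mem_filter => H; have /andP[] : (c (vertex_of T) != 0) && (vertex_of T \in A).
    apply: H; first by move=> a; rewrite mem_filter => /andP[].
    by apply/newt/in_conv_mem/map_f/vertex_of_in.
  by [].
split.
  by apply: in_conv_sub => y /mapP[a]; rewrite mem_filter => /andP[_ aA] ->; apply: map_f.
move/convA; apply: in_conv_vertices => T TT.
by apply: map_f; rewrite mem_filter cT // vertex_of_in.
Qed.

Definition block (j : 'I_k) : {set 'I_r} := [set i | B i == j].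

(** A maximal cone omits one ray per block; conversely, omitted rays chosen in all blocks form a
    transversal. *)
Lemma spans_coneP (S : {set 'I_r}) :
  spans_cone R A F b S <-> forall j, ~~ (block j \subset S).
Proof.
split=> [[sg [/is_maxconeP[T /transversal_mapP TT ->] SsubT]] j|nsub].
  apply/negP => /subset_trans/(_ SsubT)/subsetP/(_ (T j)).
  by rewrite !inE TT !eqxx => /(_ isT).
have ex j : exists i, B i = j /\ i \notin S.
  by have /subsetPn[i] := nsub j; rewrite inE => /eqP Bi niS; exists i.
have [f hf] := fin_all_exists ex.
exists [set i | i != finfun f (B i)]; split.
  apply/is_maxconeP; exists (finfun f) => //.
  by apply/transversal_mapP => j; rewrite ffunE; case: (hf j).
apply/subsetP => i iS; rewrite inE ffunE; apply/eqP => ei.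
by have [_] := hf (B i); rewrite -ei iS.
Qed.

Lemma block_inj : injective block.
Proof.
move=> j j' /setP /(_ (psi (inr j))); rewrite !inE ray_block_inr eqxx.
by move/esym/eqP.
Qed.

(** By [spans_coneP] these are the minimal sets containing a block; blocks are not nested, since
    each has its own sum ray. *)
Lemma primitive_collectionP C :
  primitive_collection R A F b C <-> exists j, C = block j.
Proof.
split=> [[nC propC]|[j ->]].
  case: (boolP [exists j, block j \subset C]) => [/existsP[j bC]|/existsPn /spans_coneP //].
  exists j; apply/eqP; rewrite eqEsubset bC andbT; apply: contraT => nCb.
  have /propC/spans_coneP/(_ j) : block j \proper C by rewrite properE bC.
  by rewrite subxx.
split=> [/spans_coneP/(_ j)|S pS]; first by rewrite subxx.
apply/spans_coneP => j'; apply/negP => bS.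
have : block j' \subset block j by apply: subset_trans bS (proper_sub pS).
move/subsetP/(_ (psi (inr j'))); rewrite !inE ray_block_inr eqxx => /(_ isT) /eqP jj'.
by case/negP: (proper_subn pS); rewrite -jj'.
Qed.

End Polytope.

(** * The Cox polynomial *)

Section CoxPolynomial.
Variables (R : realType) (n r : nat) (A : seq 'rV[int]_n) (F : 'M[int]_(n, r)).
Variables (b : 'rV[int]_r).
Implicit Type c : 'rV[int]_n -> R.

Lemma meval_fcox c (x : 'I_r -> R) :
  (fcox A F b c).@[x] = \sum_(a <- A) c a * \prod_i x i ^+ cox_exp F b a i.
Proof.
rewrite /fcox raddf_sum; apply: eq_bigr => a _ /=.
by rewrite mevalZ mevalX; congr (_ * _); apply: eq_bigr => i _; rewrite mnmE.
Qed.

Lemma msupp_fcox c m : m \in msupp (fcox A F b c) ->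
  exists2 a, a \in A & m = [multinom cox_exp F b a i | i < r].
Proof.
rewrite mcoeff_msupp /fcox raddf_sum /= => nz.
case: (boolP (has (fun a => m == [multinom cox_exp F b a i | i < r]) A))
  => [/hasP[a aA /eqP ->]|/hasPn no].
  by exists a.
case/negP: nz; rewrite big_seq big1 // => a /no /negbTE nm.
by rewrite mcoeffZ mcoeffX eq_sym nm mulr0.
Qed.

End CoxPolynomial.

Section CoxPolytope.
Variables (R : realType) (n k r : nat) (blk : 'I_n -> 'I_k) (d : 'I_k -> nat).
Variables (A : seq 'rV[int]_n) (F : 'M[int]_(n, r)) (b : 'rV[int]_r).
Variables (phi : 'I_r -> 'I_n + 'I_k) (psi : 'I_n + 'I_k -> 'I_r).
Hypothesis d_gt0 : forall j, (0 < d j)%N.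
Hypothesis convA : forall x : 'rV[R]_n,
  in_conv (map (@intvec R n) A) x <-> (forall i, 0 <= facet_val F b x i).
Hypothesis phiK : cancel phi psi.
Hypothesis psiK : cancel psi phi.
Hypothesis facetE : forall i (x : 'rV[R]_n),
  facet_val F b x i = prod_simplex_facet blk d (phi i) x.
Hypothesis uniqA : uniq A.
Implicit Type c : 'rV[int]_n -> R.

Local Notation B := (ray_block blk phi).
Local Notation vtx := (vertex_of blk d psi).
Local Notation sigma j := (\sum_(i | B i == j) 'X_i : {mpoly R[r]}).

(** Every monomial other than that of [vtx T] contains a variable evaluated at 0: otherwise the
    block sums would force equal facet values. *)
Lemma meval_fcox_vertex c (T : {ffun 'I_k -> 'I_r}) : transversal_map blk phi T ->
  (fcox A F b c).@[fun i => (i == T (B i))%:R] = c (vtx T).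
Proof.
move=> TT; rewrite meval_fcox (bigD1_seq (vtx T)) ?(vertex_of_in convA phiK psiK facetE) //=.
have vA := vertex_of_in convA phiK psiK facetE TT.
have vE i : (cox_exp F b (vtx T) i)%:R = if i == T (B i) then (d (B i))%:R else 0 :> R.
  by rewrite (cox_expE convA) // (facet_val_vertex phiK psiK facetE).
rewrite [X in _ + X]big_seq_cond [X in _ + X]big1 => [|a /andP[aA nav]].
  rewrite addr0 big1 ?mulr1 // => i _.
  have := vE i; case: (i == _) => [_|]; first by rewrite expr1n.
  by move/eqP; rewrite pnatr_eq0 => /eqP ->.
have [i niT ai] : exists2 i, i != T (B i) & cox_exp F b a i != 0%N.
  apply/exists_inP; apply: contraR nav; rewrite negb_exists_in => /forall_inP h.
  have h0 i : i != T (B i) -> facet_val F b (intvec R a) i = 0.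
    by move=> /h; rewrite negbK -(cox_expE convA) // => /eqP ->.
  apply/eqP/(@intvec_inj R)/(facet_val_inj psiK facetE) => i.
  rewrite (facet_val_vertex phiK psiK facetE) //; case: eqP => [iT|/eqP/h0//].
  rewrite -(sum_facet_val phiK psiK facetE (intvec R a) (B i)) (bigD1 i) //= big1 ?addr0 //.
  by move=> i' /andP[/eqP Bi' ne]; apply: h0; rewrite Bi' -iT.
by rewrite (bigD1 i) //= (negbTE niT) expr0n (negbTE ai) mul0r mulr0.
Qed.

(** Dehomogenization: in each block, coordinate variables are divided by the sum-ray variable, and
    multidegree [d] gives the prefactor. *)
Lemma meval_fcox_pos c (x : 'I_r -> R) : (forall i, 0 < x i) ->
  (fcox A F b c).@[x] = \prod_j x (psi (inr j)) ^+ d j *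
    leval A c (\row_m (x (psi (inl m)) / x (psi (inr (blk m))))).
Proof.
move=> x0; rewrite meval_fcox /leval mulr_sumr big_seq [RHS]big_seq.
apply: eq_bigr => a aA; rewrite mulrCA; congr (_ * _).
have inlE m : a 0 m = (cox_exp F b a (psi (inl m)))%:Z.
  apply/(@intr_inj R); rewrite [RHS](cox_expE convA) //.
  by rewrite facetE psiK /= mxE.
have inrE j : d j = (cox_exp F b a (psi (inr j)) +
    \sum_(m | blk m == j) cox_exp F b a (psi (inl m)))%N.
  rewrite -(sum_cox_exp convA phiK psiK facetE j aA) (big_rays phiK psiK) /= addnC.
  rewrite (big_pred1 j) => [|j']; last by rewrite (ray_block_inr _ psiK).
  by congr (_ + _)%N; apply: eq_bigl => m; rewrite (ray_block_inl _ psiK).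
rewrite (big_rays phiK psiK) /=.
under [X in _ = _ * X]eq_bigr => m _ do rewrite mxE inlE -exprnP expr_div_n.
rewrite big_split /= mulrCA; congr (_ * _).
under [X in _ = X * _]eq_bigr => j _ do rewrite {1}inrE exprD -prodrXr.
rewrite big_split /= -mulrA [X in _ * X](_ : _ = 1) ?mulr1 //.
rewrite (partition_big blk predT) //= -big_split big1 //= => j _.
rewrite -big_split big1 //= => m /eqP ->.
by rewrite mulfV // expf_neq0 // gt_eqF.
Qed.

Lemma fcox_multihomog c m j : m \in msupp (fcox A F b c) ->
  (\sum_(i | B i == j) m i)%N = d j.
Proof.
case/msupp_fcox => a aA ->; under eq_bigr do rewrite mnmE.
exact: (sum_cox_exp convA phiK psiK facetE).
Qed.

Lemma copositive_imp_polya c : supported_on A c -> strictly_copositive A c ->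
  newt_eq_conv A c /\ exists N, nonneg_coeffs (\prod_j sigma j ^+ N * fcox A F b c).
Proof.
move=> cA [eps eps0 cop].
(* Half of [eps] keeps [c - e] strictly within the allowed perturbation. *)
pose e (a : 'rV[int]_n) : R := if a \in A then eps / 2 else 0.
pose c' a := c a - e a.
have e0 : 0 < eps / 2 by rewrite divr_gt0.
have fc'E x : (fcox A F b c).@[x] = (fcox A F b c').@[x] + (fcox A F b e).@[x].
  rewrite !meval_fcox -big_split; apply: eq_bigr => a _ /=.
  by rewrite -mulrDl subrK.
have pos : nonneg_on_pos A c'.
  apply: cop => [a|a aA].
    by rewrite /c' /e; case: ifP => [//|nA]; rewrite subr0 => /cA; rewrite nA.
  rewrite /c' /e aA addrAC subrr add0r normrN gtr0_norm // ltr_pdivrMr //; lra.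
(* Copositivity speaks of the open orthant only, while the vertices of K lie on its boundary. *)
have fc'0 : forall x, (forall i, 0 <= x i <= 1) -> 0 <= (fcox A F b c').@[x].
  apply: meval_ge0_closure => x x0; rewrite meval_fcox_pos // mulr_ge0 //.
    by apply: prodr_ge0 => j _; rewrite exprn_ge0 // ltW.
  by apply: pos => m; rewrite mxE divr_gt0.
have vertA := vertex_of_in convA phiK psiK facetE.
split.
  apply/(newt_eq_convP d_gt0 convA phiK psiK facetE) => T TT.
  rewrite -meval_fcox_vertex // fc'E (meval_fcox_vertex e) // /e vertA //.
  rewrite gt_eqF // ltr_wpDl // fc'0 // => i.
  by case: (_ == _); rewrite lexx ler01.
(* The Cox polynomial of [e] has nonnegative coefficients and value [eps / 2] at the vertices, so
   exponent 0 suffices. *)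
have [lam lam0 hlam] : exists2 lam, 0 < lam & forall x, (forall i, 0 <= x i) ->
     (forall j, \sum_(i | B i == j) x i = 1) -> lam <= (fcox A F b e).@[x].
  apply: (@meval_lower_bound _ _ _ _ _ 0).
    rewrite expr0 mul1r => m; rewrite /fcox raddf_sum; apply: sumr_ge0 => a _ /=.
    rewrite mcoeffZ mcoeffX mulr_ge0 // /e; case: ifP => // _; exact: ltW.
  move=> T TT; rewrite meval_fcox_vertex; last by apply/transversal_mapP.
  by rewrite /e vertA ?gt_eqF //; apply/transversal_mapP.
apply: (polya_blocks (d := d) _ lam0) => [m mf j|x x0 x1]; first exact: fcox_multihomog mf.
rewrite fc'E; apply: le_trans (hlam x x0 x1) _; rewrite lerDr fc'0 // => i.
by rewrite x0 -(x1 (B i)) (bigD1 i) //= lerDl sumr_ge0.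
Qed.

Lemma polya_imp_copositive c N : newt_eq_conv A c ->
  nonneg_coeffs ((\prod_j sigma j) ^+ N * fcox A F b c) -> strictly_copositive A c.
Proof.
move=> /(newt_eq_convP d_gt0 convA phiK psiK facetE) cT hN.
have nz (T : {ffun 'I_k -> 'I_r}) : (forall j, B (T j) = j) ->
    (fcox A F b c).@[fun i => (i == T (B i))%:R] != 0.
  by move=> /transversal_mapP TT; rewrite meval_fcox_vertex // cT.
have [lam lam0 hlam] := meval_lower_bound hN nz.
(* Monomials are at most 1 on K, so the perturbation changes the value by at most [size A] times
   this bound. *)
exists (lam / (size A).+1%:R) => [|c' _ c'c t t0]; first by rewrite divr_gt0.
(* Lift of [t] to K: sum rays get 1, coordinate rays get [t 0 m], and each block is divided by its
   total [s j]. *)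
pose s j := 1 + \sum_(m | blk m == j) t 0 m.
have s0 j : 0 < s j by rewrite ltr_pwDl // sumr_ge0 // => m _; rewrite ltW.
pose x i := (match phi i with inl m => t 0 m | inr _ => 1 end) / s (B i).
have x0 i : 0 < x i by rewrite divr_gt0 //; case: (phi i).
have x1 j : \sum_(i | B i == j) x i = 1.
  rewrite /x; under eq_bigr => i /eqP -> do [].
  rewrite -mulr_suml (big_rays phiK psiK) /=.
  rewrite [X in _ + X](big_pred1 j) => [|j']; last by rewrite (ray_block_inr _ psiK).
  rewrite psiK addrC -[RHS](divff (lt0r_neq0 (s0 j))); congr ((_ + _) / _).
  apply: eq_big => m; first by rewrite (ray_block_inl _ psiK).
  by rewrite psiK.
have xt : (\row_m (x (psi (inl m)) / x (psi (inr (blk m))))) = t.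
  apply/rowP => m; rewrite mxE /x !psiK (ray_block_inl _ psiK) (ray_block_inr _ psiK).
  by rewrite div1r invrK divfK // gt_eqF.
suff : 0 <= (fcox A F b c').@[x].
  rewrite meval_fcox_pos // xt pmulr_rge0 //.
  by apply: prodr_gt0 => j _; rewrite exprn_gt0.
have fx := hlam x (fun i => ltW (x0 i)) x1.
have x01 i : 0 <= x i <= 1.
  by rewrite ltW //= -(x1 (B i)) (bigD1 i) //= lerDl sumr_ge0 // => l _; rewrite ltW.
suff : (fcox A F b c).@[x] - (fcox A F b c').@[x] <= lam by lra.
apply: le_trans (ler_norm _) _; rewrite !meval_fcox -sumrB.
apply: le_trans (ler_norm_sum _ _ _) _.
apply: le_trans (_ : \sum_(a <- A) lam / (size A).+1%:R <= _).
  rewrite big_seq [leRHS]big_seq; apply: ler_sum => a aA.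
  rewrite -mulrBl normrM distrC -[leRHS]mulr1; apply: ler_pM => //; first exact: ltW (c'c _ aA).
  rewrite normr_prod prodr_ile1 // => i _; rewrite normr_ge0 normrX.
  have /andP[xi0 xi1] := x01 i.
  by rewrite ger0_norm // exprn_ile1.
rewrite big_const_seq count_predT iter_addr_0 -[leLHS]mulr_natr mulrAC ler_pdivrMr //.
by rewrite ler_pM2l // ler_nat.
Qed.

Lemma prod_primitive_collections (PC : {set {set 'I_r}}) (N : {set 'I_r} -> nat) :
  (forall C, C \in PC <-> primitive_collection R A F b C) ->
  \prod_(C in PC) (\sum_(i in C) 'X_i) ^+ N C =
  \prod_j sigma j ^+ N (block blk phi j) :> {mpoly R[r]}.
Proof.
move=> PCE.
have -> : PC = [set block blk phi j | j in [set: 'I_k]].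
  apply/setP => C; apply/idP/imsetP.
    move/PCE/(primitive_collectionP d_gt0 convA phiK psiK facetE) => [j ->].
    by exists j.
  move=> [j _ ->]; apply/PCE/(primitive_collectionP d_gt0 convA phiK psiK facetE).
  by exists j.
rewrite big_imset /=; last by move=> j j' _ _; apply: (block_inj psiK).
apply: eq_big => [j|j _]; first by rewrite inE.
congr (_ ^+ _).
by apply: eq_bigl => i; rewrite inE.
Qed.

(** Expanding the product of block sums picks one ray per block: these are the rays missing from a
    maximal cone. *)
Lemma sum_maxcones (Sig : {set {set 'I_r}}) :
  (forall sg, sg \in Sig <-> is_maxcone R A F b sg) ->
  \sum_(sg in Sig) \prod_(i in ~: sg) 'X_i = \prod_j sigma j :> {mpoly R[r]}.
Proof.
move=> SigE.
pose cone (T : {ffun 'I_k -> 'I_r}) := [set i | i != T (B i)].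
have -> : Sig = [set cone T | T in [set T | transversal_map blk phi T]].
  apply/setP => C; apply/idP/imsetP.
    move/SigE/(is_maxconeP d_gt0 convA phiK psiK facetE) => [T TT ->].
    by exists T => //; rewrite inE.
  move=> [T TT ->]; apply/SigE/(is_maxconeP d_gt0 convA phiK psiK facetE).
  by exists T => //; rewrite inE in TT.
rewrite big_imset /=; last first.
  move=> T T'; rewrite !inE => /transversal_mapP TT /transversal_mapP TT' /setP eqT.
  apply/ffunP => j; apply/eqP; have := eqT (T j); rewrite !inE TT eqxx.
  by move/esym/negbFE.
under [RHS]eq_bigr do rewrite big_mkcond.
(* Distributivity runs over all functions; those that are not transversals contribute 0. *)
rewrite bigA_distr_bigA [RHS](bigID (transversal_map blk phi)) /=.
rewrite [X in _ = _ + X]big1 => [|T]; last first.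
  by move/forallPn => [j /negbTE nj]; rewrite (bigD1 j) //= nj mul0r.
rewrite addr0; apply: eq_big => [T|T]; rewrite inE // => /transversal_mapP TT.
have -> : ~: cone T = [set T j | j in [set: 'I_k]].
  apply/setP => i; rewrite !inE negbK; apply/eqP/imsetP => [->|[j _ ->]]; last by rewrite TT.
  by exists (B i).
rewrite big_imset /=; last by move=> j j' _ _ eqT; rewrite -(TT j) eqT TT.
by apply: eq_big => [j|j _]; rewrite ?inE // TT eqxx.
Qed.

End CoxPolytope.

Theorem mainTheorem15 (R : realType) (k : nat) (ns ds : 'I_k -> nat) (n : nat)
  (A : seq 'rV[int]_n) (r : nat) (F : 'M[int]_(n, r)) (b : 'rV[int]_r)
  (Sig PC : {set {set 'I_r}}) (c : 'rV[int]_n -> R) :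
  (forall j, (0 < ns j)%N) -> (forall j, (0 < ds j)%N) ->
  n = (\sum_(j < k) ns j)%N ->
  uniq A ->
  (forall x : 'rV[R]_n, in_conv (map (@intvec R n) A) x <->
     (forall j : 'I_k, in_conv (simplex_pts R (ns j) (ds j)) (blockv ns x j))) ->
  cox_data R A F b ->
  (forall sigma, sigma \in Sig <-> is_maxcone R A F b sigma) ->
  (forall C, C \in PC <-> primitive_collection R A F b C) ->
  supported_on A c ->
  [/\ (strictly_copositive A c ->
         newt_eq_conv A c /\
         exists N : {set 'I_r} -> nat,
           nonneg_coeffs ((\prod_(C in PC) (\sum_(i in C) 'X_i) ^+ N C) * fcox A F b c)),
      ((newt_eq_conv A c /\
         exists N : {set 'I_r} -> nat,
           nonneg_coeffs ((\prod_(C in PC) (\sum_(i in C) 'X_i) ^+ N C) * fcox A F b c)) ->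
       newt_eq_conv A c /\
         exists N : nat,
           nonneg_coeffs ((\sum_(sigma in Sig) \prod_(i in ~: sigma) 'X_i) ^+ N * fcox A F b c))
    & ((newt_eq_conv A c /\
         exists N : nat,
           nonneg_coeffs ((\sum_(sigma in Sig) \prod_(i in ~: sigma) 'X_i) ^+ N * fcox A F b c)) ->
       strictly_copositive A c)].
Proof.
move=> ns0 ds0 defn; subst n => uA convA [cox prim irr] SigE PCE cA.
pose blk := @tagnat.sig1 k ns.
have blk_surj j : exists m, blk m = j.
  by exists (tagnat.Rank j (Ordinal (ns0 j))); apply: tagnat.Rank1K.
have desc x : (forall s, 0 <= @prod_simplex_facet R _ _ blk ds s x) <->
    (forall i, 0 <= facet_val F b x i).
  rewrite -in_conv_prod_simplex // -convA; exact: cox.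
have [phi [psi [phiK psiK] facetE]] := facet_matching blk_surj ds0 desc prim irr.
split.
- move/(copositive_imp_polya ds0 cox phiK psiK facetE uA cA) => [newt [N hN]].
  split=> //; exists (fun=> N).
  by rewrite (prod_primitive_collections ds0 cox phiK psiK facetE _ PCE).
- move=> [newt [N]]; rewrite (prod_primitive_collections ds0 cox phiK psiK facetE _ PCE) => hN.
  (* This exponent dominates every [N C]; the surplus factors have nonnegative coefficients. *)
  split=> //; exists (\sum_C N C)%N.
  rewrite (sum_maxcones ds0 cox phiK psiK facetE SigE) -prodrXl.
  have -> : \prod_j (\sum_(i | ray_block blk phi i == j) 'X_i) ^+ (\sum_C N C) =
      \prod_j (\sum_(i | ray_block blk phi i == j) 'X_i)
         ^+ (\sum_C N C - N (block blk phi j)) *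
      \prod_j (\sum_(i | ray_block blk phi i == j) 'X_i) ^+ N (block blk phi j)
      :> {mpoly R[r]}.
    rewrite -big_split; apply: eq_bigr => j _ /=; rewrite -exprD subnK //.
    by rewrite (bigD1 (block blk phi j)) //= leq_addr.
  rewrite -mulrA; apply: nonneg_coeffsM => //; apply: nonneg_coeffs_prod => j.
  exact/nonneg_coeffsXn/nonneg_coeffs_sumX.
- move=> [newt [N]]; rewrite (sum_maxcones ds0 cox phiK psiK facetE SigE).
  exact: (polya_imp_copositive ds0 cox phiK psiK facetE uA newt).
Qed.
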